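(* Let $E$ and $B$ be finite $T_0$-spaces with $E\neq\varnothing$ and let $p\colon E\to B$ be a Hurewicz fibration without down beat points. Then (1) $p$ has a normalized regular path-lifting map. (2) $p$ is a Grothendieck bifibration.
   Context: A finite $T_0$-space $X$ is regarded as a poset via $x\leq y$ iff $U_x\subseteq U_y$, where $U_a$ is the smallest open set containing $a$; a poset is regarded as a small category (with one arrow $x\to y$ exactly when $x\leq y$), and continuous (i.e. order-preserving) maps as functors. A point $a\in X$ is a down beat point of $X$ if $\{x: x<a\}$ has a maximum element. For a continuous map $p\colon E\to B$ between finite $T_0$-spaces, $e\in E$ is a down beat point of $p$ if it is a down beat point of both $E$ and the fiber $p^{-1}(p(e))$. A Hurewicz fibration is a continuous map with the homotopy lifting property with respect to all topological spaces. Let $I=[0,1]$, let $B^I,E^I$ have the compact-open topology, and let $E\times_p B^I=\{(e,\gamma)\in E\times B^I: \gamma(0)=p(e)\}$. A path-lifting map for $p$ is a continuous map $\Lambda\colon E\times_p B^I\to E^I$ such that $\Lambda(e,\gamma)(0)=e$ and $p\circ\Lambda(e,\gamma)=\gamma$ for all $(e,\gamma)$. It is regular if $\Lambda(e,\gamma)$ is the constant path at $e$ whenever $\gamma$ is the constant path at $p(e)$. For a path $\gamma$ and $t\in I$ let $\gamma_{[0,t]}$ be the path $s\mapsto\gamma(st)$. A regular path-lifting map $\Lambda$ is normalized if $\Lambda(e,\gamma)_{[0,t]}=\Lambda(e,\gamma_{[0,t]})$ for all $t\in I$ and all $(e,\gamma)\in E\times_p B^I$. A functor $p\colon E\to B$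 between small categories is a Grothendieck fibration if for all $e\in E$ and all arrows $f\colon b\to p(e)$ of $B$ there is a cartesian arrow $\tilde f\colon e'\to e$ of $E$ with $p(\tilde f)=f$; here an arrow $f\colon e'\to e$ is cartesian if for all $g\colon e''\to e$ in $E$ and $h\colon p(e'')\to p(e')$ in $B$ with $p(g)=p(f)h$ there is a unique $\tilde h\colon e''\to e'$ with $f\tilde h=g$ and $p(\tilde h)=h$. It is a Grothendieck opfibration if $p^{\mathrm{op}}$ is a Grothendieck fibration, and a Grothendieck bifibration if it is both. *)

(* Defs.v *)
From HB Require Import structures.
From mathcomp Require Import all_boot all_order all_algebra.
From mathcomp Require Import all_classical all_reals topology.
From mathcomp Require Import normedtype.

Set Implicit Arguments.
Unset Strict Implicit.
Unset Printing Implicit Defensive.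

Import Order.TTheory GRing.Theory Num.Theory.
Import numFieldNormedType.Exports.

Local Open Scope classical_set_scope.
Local Open Scope ring_scope.

(* In a finite space this intersection is open, so it is the smallest open set
   containing [a]. *)
Definition min_open (X : topologicalType) (a : X) : set X :=
  \bigcap_(U in open_nbhs a) U.

Definition spec_le (X : topologicalType) (x y : X) : Prop :=
  min_open x `<=` min_open y.

Definition spec_lt (X : topologicalType) (x y : X) : Prop :=
  spec_le x y /\ x <> y.

Lemma spec_le_refl (X : topologicalType) (x : X) : spec_le x x.
Proof. by []. Qed.

Lemma spec_le_trans (X : topologicalType) (x y z : X) :
  spec_le x y -> spec_le y z -> spec_le x z.
Proof. exact: subset_trans. Qed.

Lemma spec_le_open (X : topologicalType) (x y : X) :
  spec_le x y <-> (forall U : set X, open U -> U y -> U x).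
Proof.
split=> [xy U oU Uy|xy z xz U [oU Uy]]; last by apply: xz; split; last exact: xy.
by apply: (xy x) => // V [].
Qed.

Lemma continuous_spec_le (X Y : topologicalType) (f : X -> Y) (x y : X) :
  continuous f -> spec_le x y -> spec_le (f x) (f y).
Proof.
move=> /continuousP cf /spec_le_open xy; apply/spec_le_open => U oU Ufy.
exact: (xy _ (cf _ oU)).
Qed.

Definition down_beat_point (X : topologicalType) (a : X) : Prop :=
  exists2 m : X, spec_lt m a & forall x : X, spec_lt x a -> spec_le x m.

Definition fiber (E B : topologicalType) (p : E -> B) (b : B) : set E :=
  p @^-1` [set b].

Definition fiber_point (E B : topologicalType) (p : E -> B) (e : E) :
    fiber p (p e) :=
  exist _ e (mem_set (erefl (p e) : fiber p (p e) e)).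

Definition map_down_beat_point (E B : topologicalType) (p : E -> B) (e : E) :
    Prop :=
  down_beat_point e /\ down_beat_point (fiber_point p e).

Definition unit_interval (R : realType) : set R := `[0, 1].
Arguments unit_interval R : clear implicits.

Lemma unit_interval0 (R : realType) : unit_interval R 0.
Proof. by rewrite /unit_interval /= in_itv /= lexx ler01. Qed.

Definition I0 (R : realType) : unit_interval R :=
  exist _ 0 (mem_set (unit_interval0 R)).

Lemma unit_interval_mul (R : realType) (s t : unit_interval R) :
  unit_interval R (set_val s * set_val t).
Proof.
have := (set_valP s, set_valP t); rewrite /unit_interval /= !in_itv /=.
move=> [/andP[s0 s1] /andP[t0 t1]]; rewrite mulr_ge0 //=.
by rewrite -[leRHS](mulr1 1) ler_pM.
Qed.

Definition Imul (R : realType) (s t : unit_interval R) : unit_interval R :=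
  exist _ (set_val s * set_val t) (mem_set (unit_interval_mul s t)).

Lemma Imul0 (R : realType) (t : unit_interval R) : Imul (I0 R) t = I0 R.
Proof. by apply: eq_sig_hprop => [?|/=]; [exact: Prop_irrelevance|exact: mul0r]. Qed.

Lemma Imul_continuous (R : realType) (t : unit_interval R) :
  continuous (fun s : unit_interval R => Imul s t).
Proof.
apply: continuous_comp_initial => s.
apply: (@cvgM _ _ (nbhs s) (nbhs_filter s) set_val (cst (set_val t))).
  exact: (@initial_continuous (unit_interval R) R set_val).
exact: cvg_cst.
Qed.

(* The space T^I with the compact-open topology. *)
Definition path_space (R : realType) (T : topologicalType) : Type :=
  continuousType (unit_interval R) T.

HB.instance Definition _ (R : realType) (T : topologicalType) :=
  Topological.copy (path_space R T)
    (initial_topology (fun c : continuousType (unit_interval R) T =>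
       (c : {compact-open, unit_interval R -> T}))).

Definition cst_path (R : realType) (T : topologicalType) (x : T) :
    path_space R T :=
  (cst x : continuousType (unit_interval R) T).

Section trunc_path.
Context (R : realType) (T : topologicalType).
Context (c : path_space R T) (t : unit_interval R).

Let trunc_fun (s : unit_interval R) : T := c (Imul s t).

Let trunc_fun_continuous : continuous trunc_fun.
Proof.
move=> s; apply: (@continuous_comp _ _ _ (fun s => Imul s t) c).
  exact: Imul_continuous.
exact: cts_fun.
Qed.

Definition trunc_path : path_space R T :=
  (mkcts trunc_fun_continuous : continuousType (unit_interval R) T).

Lemma trunc_pathE (s : unit_interval R) : trunc_path s = c (Imul s t).
Proof. by []. Qed.

Lemma trunc_path0 : trunc_path (I0 R) = c (I0 R).
Proof. by rewrite trunc_pathE Imul0. Qed.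

End trunc_path.

Definition hurewicz_fibration (R : realType) (E B : topologicalType)
    (p : E -> B) : Prop :=
  continuous p /\
  forall (X : topologicalType) (f : X -> E) (H : X * unit_interval R -> B),
    continuous f -> continuous H ->
    (forall x : X, H (x, I0 R) = p (f x)) ->
    exists G : X * unit_interval R -> E,
      [/\ continuous G,
          forall x : X, G (x, I0 R) = f x &
          forall z : X * unit_interval R, p (G z) = H z].

Section path_lifting.
Context (R : realType) (E B : topologicalType) (p : E -> B).

Definition lift_domain : set (E * path_space R B) :=
  [set z : E * path_space R B | z.2 (I0 R) = p z.1].

Definition lift_pair (e : E) (c : path_space R B) (h : c (I0 R) = p e) :
    lift_domain :=
  exist _ (e, c) (mem_set (h : lift_domain (e, c))).

Lemma lift_domainP (z : lift_domain) :
  (set_val z).2 (I0 R) = p (set_val z).1.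
Proof. exact: set_mem (valP z). Qed.

Definition lift_cst (e : E) : lift_domain :=
  @lift_pair e (cst_path R (p e)) erefl.

Definition lift_trunc (z : lift_domain) (t : unit_interval R) : lift_domain :=
  lift_pair (etrans (trunc_path0 (set_val z).2 t) (lift_domainP z)).

Definition path_lifting_map (L : lift_domain -> path_space R E) : Prop :=
  [/\ continuous L,
      forall z : lift_domain, L z (I0 R) = (set_val z).1 &
      forall z : lift_domain, p \o L z = (set_val z).2 :> (_ -> B)].

Definition regular_lifting (L : lift_domain -> path_space R E) : Prop :=
  forall e : E, L (lift_cst e) = cst_path R e.

Definition normalized_lifting (L : lift_domain -> path_space R E) : Prop :=
  forall (z : lift_domain) (t : unit_interval R),
    trunc_path (L z) t = L (lift_trunc z t).

End path_lifting.
Arguments lift_domain R {E B} p _.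

Record category := Category {
  ob :> Type;
  hom : ob -> ob -> Type;
  idc : forall x, hom x x;
  compc : forall x y z, hom y z -> hom x y -> hom x z;
  compc1 : forall x y (f : hom x y), compc f (idc x) = f;
  comp1c : forall x y (f : hom x y), compc (idc y) f = f;
  compcA : forall x y z t (h : hom z t) (g : hom y z) (f : hom x y),
    compc h (compc g f) = compc (compc h g) f }.

Record functor (C D : category) := Functor {
  fob :> C -> D;
  fmap : forall x y, hom x y -> hom (fob x) (fob y);
  fmap1 : forall x, fmap (idc x) = idc (fob x);
  fmapM : forall x y z (g : hom y z) (f : hom x y),
    fmap (compc g f) = compc (fmap g) (fmap f) }.

Definition op_category (C : category) : category :=
  @Category C (fun x y => hom y x) (@idc C) (fun x y z g f => compc f g)
    (fun x y f => comp1c f) (fun x y f => compc1 f)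
    (fun x y z t h g f => esym (compcA f g h)).

Definition op_functor (C D : category) (F : functor C D) :
    functor (op_category C) (op_category D) :=
  @Functor (op_category C) (op_category D) F (fun x y f => fmap F f)
    (fmap1 F) (fun x y z g f => fmapM F f g).

Definition cartesian (C D : category) (p : functor C D) (e' e : C)
    (f : hom e' e) : Prop :=
  forall (e'' : C) (g : hom e'' e) (h : hom (p e'') (p e')),
    fmap p g = compc (fmap p f) h ->
    exists! k : hom e'' e', compc f k = g /\ fmap p k = h.

(* The equality in the sigma type says [p e' = b] and, along this identification
   of sources, [fmap p k = f]. *)
Definition grothendieck_fibration (C D : category) (p : functor C D) : Prop :=
  forall (e : C) (b : D) (f : hom b (p e)),
    exists (e' : C) (k : hom e' e),
      cartesian p k /\
      existT (fun x : D => hom x (p e)) (p e') (fmap p k) =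
      existT (fun x : D => hom x (p e)) b f.

Definition grothendieck_opfibration (C D : category) (p : functor C D) : Prop :=
  grothendieck_fibration (op_functor p).

Definition grothendieck_bifibration (C D : category) (p : functor C D) : Prop :=
  grothendieck_fibration p /\ grothendieck_opfibration p.

Definition space_category (X : topologicalType) : category :=
  @Category X (@spec_le X) (@spec_le_refl X)
    (fun x y z yz xy => spec_le_trans xy yz)
    (fun x y f => Prop_irrelevance _ _) (fun x y f => Prop_irrelevance _ _)
    (fun x y z t h g f => Prop_irrelevance _ _).

Definition space_functor (X Y : topologicalType) (f : continuousType X Y) :
    functor (space_category X) (space_category Y) :=
  @Functor (space_category X) (space_category Y) f
    (fun x y => @continuous_spec_le X Y f x y cts_fun)
    (fun x => @Prop_irrelevance (spec_le (f x) (f x)) _ _)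
    (fun x y z g h => @Prop_irrelevance (spec_le (f x) (f z)) _ _).

(* Main.v *)
(* Lifting the evaluation homotopy over the space of all pairs (e, c) with
   c 0 = p e and evaluating at a small time t > 0 gives a monotone transport T.
   On constant paths T is a self-map of p below the identity, and without down
   beat points it is the identity. Monotonicity of T, applied to a constant path
   and to a path with a single jump, shows that T along the jump is an extremal
   element: a jump down gives the cartesian lift, and a jump up (at time t) the
   opcartesian lift.

   A path c in B is dominated near each time m by c m, so a compact interval can
   be cut into pieces [u, v] on which c <= c m for some m in [u, v]. On such a
   piece, lift opcartesianly from c u to c m and then cartesianly down to c v.
   Refining the subdivision lowers the endpoint and subdivisions are directed,
   so E being finite there is a least endpoint. It depends only on the path up
   to the current time, is unchanged by rescaling, is e for a constant path, and
   varies continuously: this is the normalized regular path-lifting map. *)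
Require Import Defs.
From mathcomp Require Import all_boot all_order all_algebra finmap.
From mathcomp Require Import all_classical all_reals topology normedtype.
From mathcomp Require Import lra.
Set Implicit Arguments.
Unset Strict Implicit.
Unset Printing Implicit Defensive.
Import Order.TTheory GRing.Theory Num.Theory.
Import numFieldNormedType.Exports.

Local Open Scope classical_set_scope.
Local Open Scope ring_scope.

Local Notation "x <=: y" := (spec_le x y) (at level 70).

(** * Finite T0-spaces as posets *)

Lemma spec_le_anti (X : topologicalType) (x y : X) :
  kolmogorov_space X -> x <=: y -> y <=: x -> x = y.
Proof.
move=> kX /spec_le_open xy /spec_le_open yx.
apply/eqP/negPn/negP => /kX[A [][]]; rewrite !inE nbhsE => -[U [oU Ux] UA] /=.
  by apply; apply: UA; exact: yx.
by apply; apply: UA; exact: xy.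
Qed.

Lemma finite_filter_forall (T : Type) (I : choiceType) (F : set_system T)
    (f : I -> set T) :
  Filter F -> finite_set [set: I] -> (forall i, F (f i)) ->
  F [set x | forall i, f i x].
Proof.
move=> FF /finite_fsetP[D DE] Ff.
apply: filterS (@filter_bigI _ _ D f _ FF (fun i _ => Ff i)) => x fx i.
by apply: fx; rewrite -DE.
Qed.

(** Each of the finitely many points not below [x] is avoided by some open neighbourhood of [x];
    intersect these neighbourhoods. *)
Lemma finite_near_spec_le (X : topologicalType) (x : X) :
  finite_set [set: X] -> \forall y \near x, y <=: x.
Proof.
move=> fX.
suff : nbhs x [set z | forall y : X, z = y -> y <=: x].
  by apply: filterS => z /(_ z erefl).
apply: finite_filter_forall => // y.
have [yx|nyx] := pselect (y <=: x); first by apply: filterE.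
have [U [oU Ux nUy]] : exists U : set X, [/\ open U, U x & ~ U y].
  apply: contrapT => nU; apply: nyx; apply/spec_le_open => U oU Ux.
  by apply: contrapT => nUy; apply: nU; exists U.
by apply: filterS (open_nbhs_nbhs (conj oU Ux)) => z Uz zy; case: nUy; rewrite -zy.
Qed.

(** The size [N] of the down-set is strictly monotone by antisymmetry, so a point of [P] minimizing
    [N] works. *)
Lemma finite_minimal (X : topologicalType) (P : set X) :
  finite_set [set: X] -> kolmogorov_space X -> P !=set0 ->
  exists2 x, P x & forall y, P y -> y <=: x -> y = x.
Proof.
move=> fX kX [x0 Px0].
pose N (x : X) := #|` fset_set [set y | y <=: x]|%fset.
have fin x : finite_set [set y : X | y <=: x] by exact: sub_finite_set fX.
have exP : exists n, `[< exists2 x, P x & N x = n >].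
  by exists (N x0); apply/asboolP; exists x0.
case: (ex_minnP exP) => n /asboolP[x Px Nx] minn; exists x => // y Py yx.
apply: contrapT => nxy.
have : (N y < N x)%N.
  apply: fproper_ltn_card; apply/andP; split.
    apply/fsubsetP => z; rewrite !in_fset_set // !inE => zy.
    exact: spec_le_trans zy yx.
  apply/negP => /fsubsetP/(_ x).
  rewrite !in_fset_set // !inE => /(_ (@spec_le_refl _ x)) xy.
  by apply: nxy; exact: spec_le_anti.
by rewrite Nx ltnNge minn //; apply/asboolP; exists y.
Qed.

(** * Lifts along subdivisions of an interval *)

Section fence.
Context (R : realType) (E B : topologicalType) (p : E -> B).

(** The poset form of a choice of opcartesian arrows; [up e b] is unconstrained unless
    [p e <=: b]. *)
Definition opcartesian_lift (up : E -> B -> E) : Prop :=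
  forall e b, p e <=: b ->
  [/\ e <=: up e b, p (up e b) = b &
      forall y, e <=: y -> b <=: p y -> up e b <=: y].

Definition cartesian_lift (dn : E -> B -> E) : Prop :=
  forall e b, b <=: p e ->
  [/\ dn e b <=: e, p (dn e b) = b &
      forall x, x <=: e -> p x <=: b -> x <=: dn e b].

Context (up dn : E -> B -> E).
Context (upP : opcartesian_lift up) (dnP : cartesian_lift dn).

(* [fence g s x t y]: [y] is the endpoint of a lift from [x] along [g] on [s, t],
   each step rising to the dominating value [g m] before descending to [g v]. *)
Inductive fence (g : R -> B) (s : R) (x : E) : R -> E -> Prop :=
| fence_nil : fence g s x s x
| fence_step u y m v : fence g s x u y -> u < v -> u <= m <= v ->
    (forall r, u <= r <= v -> g r <=: g m) ->
    fence g s x v (dn (up y (g m)) (g v)).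

Implicit Types g : R -> B.

Lemma fence_le g s x t y : fence g s x t y -> s <= t.
Proof.
by elim=> // u {}y m v _ su uv _ _; rewrite (le_trans su) ?ltW.
Qed.

Lemma fence_eq g s x y : fence g s x s y -> y = x.
Proof.
have : forall t, fence g s x t y -> t = s -> y = x.
  move=> t; case=> // u y' m v /fence_le su uv _ _ vs.
  by move: uv; rewrite vs ltNge su.
by move=> /[apply]; exact.
Qed.

Lemma fence_cat g s x t y u z :
  fence g s x t y -> fence g t y u z -> fence g s x u z.
Proof. by move=> xy; elim=> // v w m {}u _ f vu mI gm; exact: fence_step f vu mI gm. Qed.

Lemma fence_fiber g s x t y : p x = g s -> fence g s x t y -> p y = g t.
Proof.
move=> px; elim=> // u {}y m v _ py uv /andP[um mv] gm.
have [|_ pup _] := @upP y (g m); first by rewrite py; apply: gm; rewrite lexx ltW.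
by have [|//] := @dnP (up y (g m)) (g v); rewrite pup; apply: gm; rewrite lexx ltW.
Qed.

(** Induction on the steps: the opcartesian property keeps each rise below [z], and the descent only
    lowers it. *)
Lemma fence_bound g s x t y z : p x = g s -> fence g s x t y -> x <=: z ->
  (forall r, s <= r <= t -> g r <=: p z) -> y <=: z.
Proof.
move=> px + xz; elim=> // u {}y m v f IH uv /andP[um mv] gm gz.
have su := fence_le f.
have {}IH : y <=: z.
  by apply: IH => r /andP[sr ru]; apply: gz; rewrite sr (le_trans ru (ltW uv)).
have py := fence_fiber px f.
have [|_ pup upm] := @upP y (g m); first by rewrite py; apply: gm; rewrite lexx ltW.
have [|dnle _ _] := @dnP (up y (g m)) (g v).
  by rewrite pup; apply: gm; rewrite lexx ltW.
apply: spec_le_trans dnle _; apply: upm => //; apply: gz.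
by rewrite mv (le_trans su um).
Qed.

(** Refinement lowers the endpoint: the top [up y (g m)] of the single step bounds every fence on
    [[u, v]] by [fence_bound], and the cartesian property pushes this bound down to the fiber over
    [g v]. *)
Lemma fence_bound_step g u y m v y0 z : p y = g u -> p y0 = g u -> y0 <=: y ->
  u <= m <= v -> (forall r, u <= r <= v -> g r <=: g m) ->
  fence g u y0 v z -> z <=: dn (up y (g m)) (g v).
Proof.
move=> py py0 y0y /andP[um mv] gm f.
have uv := le_trans um mv.
have [|yup pup _] := @upP y (g m); first by rewrite py; apply: gm; rewrite lexx.
have [|_ _ dnm] := @dnP (up y (g m)) (g v).
  by rewrite pup; apply: gm; rewrite lexx uv.
apply: dnm; last by rewrite (fence_fiber py0 f); exact: spec_le_refl.
apply: (fence_bound py0 f); first exact: spec_le_trans y0y yup.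
by move=> r rI; rewrite pup; exact: gm.
Qed.

(** The order form of continuity for a path in a finite space. *)
Definition locally_below g : Prop := forall t, \forall r \near t, g r <=: g t.

Lemma locally_belowP g t : locally_below g ->
  exists2 e, 0 < e & forall r, `|r - t| < e -> g r <=: g t.
Proof.
move=> /(_ t) /nbhs_ballP[e /= e0 be]; exists e => // r rt; apply: be.
by rewrite /ball /= distrC.
Qed.

Lemma fence_exists g s x t : locally_below g -> p x = g s -> s <= t ->
  exists y, fence g s x t y.
Proof.
move=> gl px st.
(* Compactness of [[s, t]] through a supremum: near [c = sup A] the value [g c] dominates, so one
   step with [m = c] carries a fence from just before [c] to just after it. *)
pose A := [set u | u <= t /\ exists y, fence g s x u y].
have As : A s by split=> //; exists x; exact: fence_nil.
have supA : has_sup A by split; [exists s|exists t => u []].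
set c := sup A.
have sc : s <= c by exact: ub_le_sup supA.2 _ As.
have ct : c <= t by apply: ge_sup; [exists s|move=> u []].
have [e e0 ge] := locally_belowP c gl.
have [u [ut [y f]] uc] : exists2 u, A u & c - e < u by exact: sup_adherent.
have cu : u <= c by apply: ub_le_sup supA.2 _ _; split=> //; exists y.
have step v : c <= v -> v < c + e -> exists z, fence g s x v z.
  move=> cv ve; have [uv|vu] := ltP u v; last first.
    have -> : v = u by apply/eqP; rewrite eq_le vu (le_trans cu cv).
    by exists y.
  exists (dn (up y (g c)) (g v)); apply: fence_step f uv _ _; first exact/andP.
  move=> r /andP[ur rv]; apply: ge; rewrite ltr_norml.
  by apply/andP; split; lra.
have [tc|tc] := ltP t (c + e); first exact: step.
(* If [c + e <= t], the fence reaches past [c], contradicting the supremum. *)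
have Ac : A (c + e / 2).
  split; first by lra.
  by apply: step; lra.
by have := ub_le_sup supA.2 Ac; rewrite -/c; lra.
Qed.

(* A step of the given fence straddling [u] is replaced by arbitrary fences on
   its two halves: these do not exceed the step by [fence_bound_step]. *)
Lemma fence_split g s x u v z : locally_below g -> p x = g s ->
  fence g s x v z -> s <= u <= v ->
  exists2 y, fence g s x u y &
    forall y0, p y0 = g u -> y0 <=: y -> exists2 z0, fence g u y0 v z0 & z0 <=: z.
Proof.
move=> gl px; elim=> [|a {}z m w f IH aw mI gm] /andP[su uv].
  have us : u = s by apply/eqP; rewrite eq_le su uv.
  rewrite us; exists x; first exact: fence_nil.
  by move=> y0 _ y0x; exists y0 => //; exact: fence_nil.
have pz := fence_fiber px f.
have [ua|au] := leP u a.
  have [|y fy yP] := IH; first by rewrite su.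
  exists y => // y0 py0 /(yP _ py0)[z0 f0 z0z].
  exists (dn (up z0 (g m)) (g w)); first exact: fence_step f0 aw mI gm.
  apply: (fence_bound_step pz (fence_fiber py0 f0) z0z mI gm).
  by apply: fence_step aw mI gm; exact: fence_nil.
have [y fy] := fence_exists gl pz (ltW au).
have /andP[am mw] := mI.
have [|zup pup _] := @upP z (g m); first by rewrite pz; apply: gm; rewrite lexx ltW.
have [|_ _ dnm] := @dnP (up z (g m)) (g w).
  by rewrite pup; apply: gm; rewrite lexx ltW.
exists y; first exact: fence_cat f fy.
move=> y0 py0 y0y; have [z0 f0] := fence_exists gl py0 uv; exists z0 => //.
apply: dnm; last by rewrite (fence_fiber py0 f0); exact: spec_le_refl.
apply: (fence_bound py0 f0).
  apply: spec_le_trans y0y _; apply: (fence_bound pz fy) zup _.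
  by move=> r /andP[ar ru]; rewrite pup; apply: gm; rewrite ar (le_trans ru uv).
move=> r /andP[ur rw]; rewrite pup; apply: gm.
by rewrite rw andbT (le_trans (ltW au) ur).
Qed.

(** Induction on the first fence: for its last step on [[u, v]], split the second fence at [u], take
    a common lower bound [y0] there, and continue from [y0] by the tail of the second fence;
    [fence_bound_step] compares this with the last step of the first. *)
Lemma fence_directed g s x t y1 y2 : locally_below g -> p x = g s ->
  fence g s x t y1 -> fence g s x t y2 ->
  exists y, [/\ fence g s x t y, y <=: y1 & y <=: y2].
Proof.
move=> gl px f1; elim: f1 y2 => [y2 /fence_eq ->|u y m v f IH uv mI gm y2 f2].
  by exists x; split=> //; exact: fence_nil.
have su := fence_le f.
have [|y' f' y'P] := fence_split gl px f2 (u := u); first by rewrite su ltW.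
have [y0 [f0 y0y y0y']] := IH _ f'.
have py0 := fence_fiber px f0.
have [z0 fz0 z0y2] := y'P _ py0 y0y'.
exists z0; split=> //; first exact: fence_cat f0 fz0.
exact: (fence_bound_step (fence_fiber px f) py0 y0y mI gm fz0).
Qed.

(** Needed for continuity at [t] from the left: some fence already lies below [y] at an earlier
    time, from which [g] stays below [g t]. *)
Lemma fence_before g s x t y : locally_below g -> p x = g s ->
  fence g s x t y -> s < t ->
  exists u y1, [/\ s <= u < t, fence g s x u y1, y1 <=: y &
                   forall r, u <= r <= t -> g r <=: g t].
Proof.
move=> gl px [|u {}y m v f uv mI gm] st; first by rewrite ltxx in st.
have [e e0 ge] := locally_belowP v gl.
(* The cut lies inside the last step and within [e] of its end, so both dominations [g m] and [g v]
   are available. *)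
pose w := Num.max u (v - e / 2).
have [uw wv ew] : [/\ u <= w, w < v & v - e / 2 <= w].
  by rewrite !le_max !gt_max !lexx orbT; split=> //; apply/andP; split=> //; lra.
have wP r : w <= r <= v -> g r <=: g v.
  move=> /andP[wr rv]; apply: ge; rewrite ltr_norml.
  by apply/andP; split; lra.
have py := fence_fiber px f.
have /andP[um mv] := mI.
have [|yup pup _] := @upP y (g m); first by rewrite py; apply: gm; rewrite lexx ltW.
have [|_ _ dnm] := @dnP (up y (g m)) (g v).
  by rewrite pup; apply: gm; rewrite lexx ltW.
have [y1 f1] := fence_exists gl py uw.
exists w, y1; split=> //; last first.
- apply: dnm; last by rewrite (fence_fiber py f1); apply: wP; rewrite lexx ltW.
  apply: (fence_bound py f1) yup _ => r /andP[ur rw]; rewrite pup; apply: gm.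
  by rewrite ur (le_trans rw (ltW wv)).
- exact: fence_cat f f1.
- by rewrite wv (le_trans (fence_le f) uw).
Qed.

(** Subdivisions are insensitive to rescaling of time; this is the source of normalization. *)
Lemma fence_scale g s x u y (t : R) : 0 < t ->
  fence (fun r => g (r * t)) s x u y -> fence g (s * t) x (u * t) y.
Proof.
move=> t0; elim=> [|{}u {}y m v _ f uv /andP[um mv] gm]; first exact: fence_nil.
apply: fence_step f _ _ _; rewrite ?ltr_pM2r ?ler_pM2r //; first exact/andP.
move=> r /andP[ur rv]; rewrite -[r](divfK (lt0r_neq0 t0)); apply: gm.
by rewrite ler_pdivlMr // ler_pdivrMr // ur.
Qed.

Lemma eq_fence g h s x t y : (forall r, s <= r <= t -> g r = h r) ->
  fence g s x t y -> fence h s x t y.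
Proof.
move=> + f; elim: f => [|u {}y m v f IH uv /andP[um mv] gm] gh.
  by move=> *; exact: fence_nil.
have su := fence_le f.
rewrite !gh ?(le_trans su um) ?(le_trans su (ltW uv)) ?lexx //.
apply: fence_step; first apply: IH.
- by move=> r /andP[sr ru]; apply: gh; rewrite sr (le_trans ru (ltW uv)).
- by [].
- exact/andP.
- move=> r /andP[ur rv]; rewrite -!gh ?(le_trans su um) ?(le_trans su ur) //.
  by apply: gm; rewrite ur.
Qed.

(** Lifts of identities are identities by antisymmetry; this gives regularity. *)
Lemma fence_cst g s x t y : kolmogorov_space E -> (forall r, g r = p x) ->
  fence g s x t y -> y = x.
Proof.
move=> kE gx; elim=> // u {}y m v _ -> _ _ _; rewrite !gx.
have [|xup pup upm] := @upP x (p x); first exact: spec_le_refl.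
have -> : up x (p x) = x.
  by apply: spec_le_anti => //; apply: upm; exact: spec_le_refl.
have [|dnx _ dnm] := @dnP x (p x); first exact: spec_le_refl.
by apply: spec_le_anti => //; apply: dnm; exact: spec_le_refl.
Qed.

Definition least_fence g s x t y : Prop :=
  fence g s x t y /\ forall z, fence g s x t z -> y <=: z.

(** A minimal endpoint is least because endpoints are directed downwards. *)
Lemma least_fence_exists g s x t : finite_set [set: E] -> kolmogorov_space E ->
  locally_below g -> p x = g s -> s <= t -> exists y, least_fence g s x t y.
Proof.
move=> fE kE gl px st.
have [y f ymin] := finite_minimal fE kE (fence_exists gl px st).
exists y; split=> // z fz; have [w [fw wy wz]] := fence_directed gl px f fz.
by rewrite -(ymin _ fw wy).
Qed.

End fence.

(** Open sets are down-sets, so this order condition implies continuity at [x]. *)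
Lemma cvg_spec_le (X Y : topologicalType) (f : X -> Y) (x : X) :
  (\forall z \near x, f z <=: f x) -> f @ x --> f x.
Proof.
move=> fx U; rewrite nbhsE => -[V [oV Vfx] VU].
by apply: filterS fx => z /spec_le_open fz; apply: VU; exact: fz.
Qed.

(** * The unit interval as a retract of the line, and evaluation of paths *)

Section clamp.
Context {R : realType}.

Lemma clamp_subproof (r : R) : unit_interval R (Num.max 0 (Num.min r 1)).
Proof. by rewrite /unit_interval /= in_itv /= le_max lexx ge_max ge_min lexx ler01 orbT. Qed.

(** This retraction extends paths to all of [R], so that fences can be indexed by real times. *)
Definition clamp (r : R) : unit_interval R :=
  exist _ (Num.max 0 (Num.min r 1)) (mem_set (clamp_subproof r)).

Lemma clampE (r : R) : 0 <= r <= 1 -> set_val (clamp r) = r.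
Proof.
by move=> /andP[r0 r1]; rewrite set_valE /= min_l // max_r.
Qed.

Lemma unit_intervalP (t : unit_interval R) : 0 <= set_val t <= 1.
Proof. by have := set_valP t; rewrite /unit_interval /= in_itv. Qed.

Lemma unit_interval_inj (s t : unit_interval R) : set_val s = set_val t -> s = t.
Proof. exact: val_inj. Qed.

Lemma clampK (t : unit_interval R) : clamp (set_val t) = t.
Proof. by apply: unit_interval_inj; rewrite clampE // unit_intervalP. Qed.

Lemma clamp_continuous : continuous clamp.
Proof.
apply: continuous_comp_initial => r.
apply: (@continuous_max _ _ (cst 0) (fun r : R => Num.min r 1)); first exact: cvg_cst.
by apply: (@continuous_min _ _ id (cst 1)); [exact: cvg_id|exact: cvg_cst].
Qed.

Lemma set_val_continuous : continuous (set_val : unit_interval R -> R).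
Proof. exact: (@initial_continuous (unit_interval R) R set_val). Qed.

Lemma clamp_compact (a b : R) : compact (clamp @` `[a, b]).
Proof.
apply: continuous_compact; last exact: segment_compact.
exact/continuous_subspaceT/clamp_continuous.
Qed.

Lemma unit_interval_compact : compact [set: unit_interval R].
Proof.
suff -> : [set: unit_interval R] = clamp @` `[0, 1] by exact: clamp_compact.
apply/esym; rewrite -subTset => t _; exists (set_val t); last exact: clampK.
by rewrite /= in_itv /= unit_intervalP.
Qed.

(** Uncurrying is continuous because the unit interval is compact and regular. *)
Lemma path_eval_continuous (T : topologicalType) :
  continuous (fun z : path_space R T * unit_interval R => z.1 z.2).
Proof.
have -> : (fun z : path_space R T * unit_interval R => z.1 z.2) =
    uncurry (fun c : path_space R T => (c : {compact-open, unit_interval R -> T})).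
  by apply/funext => -[].
apply: continuous_uncurry_regular.
- move=> t _; exists setT; first by apply: filterT.
  by split; [exact: unit_interval_compact|exact: closedT].
- exact: uniform_regular.
- exact: initial_continuous.
- by move=> c; exact: cts_fun.
Qed.

Lemma path_ext (T : topologicalType) (c d : path_space R T) : c =1 d -> c = d.
Proof. by move=> /funext cd; apply/continuousEP => t; rewrite cd. Qed.

End clamp.

(** * The least endpoint as a path-lifting map *)

Section fence_lifting.
Context (R : realType) (E B : topologicalType) (p : E -> B).
Context (up dn : E -> B -> E).
Context (upP : opcartesian_lift p up) (dnP : cartesian_lift p dn).
Context (fE : finite_set [set: E]) (kE : kolmogorov_space E).
Context (fB : finite_set [set: B]).

Local Notation dom := (set_type (lift_domain R p)).

Definition base_path (z : dom) (r : R) : B := (set_val z).2 (clamp r).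
Let start (z : dom) : E := (set_val z).1.

Lemma base_path_below z : locally_below (base_path z).
Proof.
move=> t.
have c : {for t, continuous (base_path z)}.
  by apply: continuous_comp; [exact: clamp_continuous|exact: cts_fun].
exact: c (finite_near_spec_le _ fB).
Qed.

Lemma clamp0 : clamp 0 = I0 R.
Proof. by apply: unit_interval_inj; rewrite clampE ?lexx ?ler01. Qed.

Lemma base_path0 z : p (start z) = base_path z 0.
Proof. by rewrite /base_path clamp0 (lift_domainP z). Qed.

(** The down-set of [y] is open as [B] is finite, and the image of [[a, b]] is compact, so the
    condition is open in the compact-open topology. *)
Lemma base_path_near z (a b : R) (y : B) :
  (forall r, a <= r <= b -> base_path z r <=: y) ->
  \forall z' \near z, forall r, a <= r <= b -> base_path z' r <=: y.
Proof.
move=> zy; pose O := [set x : B | x <=: y].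
have oO : open O.
  rewrite openE => x Ox; apply: filterS (finite_near_spec_le x fB) => x' x'x.
  exact: spec_le_trans x'x Ox.
have oK : open ([set g | g @` (clamp @` `[a, b]) `<=` O] :
    set {compact-open, unit_interval R -> B}).
  by apply: compact_open_open => //; exact: clamp_compact.
have c : continuous (fun z : dom => ((set_val z).2 : {compact-open, unit_interval R -> B})).
  move=> w; apply: (@continuous_comp _ _ _ (fun z : dom => (set_val z).2)
    (fun c : path_space R B => (c : {compact-open, unit_interval R -> B}))).
    apply: (@continuous_comp _ _ _ set_val snd); last exact: cvg_snd.
    exact: (@initial_continuous dom _ set_val).
  exact: initial_continuous.
have O_nbhs : nbhs ((set_val z).2 : {compact-open, unit_interval R -> B})
    [set g : {compact-open, unit_interval R -> B} | g @` (clamp @` `[a, b]) `<=` O].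
  apply: open_nbhs_nbhs; split=> // _ [_ [r rab <-] <-]; apply: zy.
  by move: rab; rewrite /= in_itv.
have cz : nbhs z [set z' : dom | (set_val z').2 @` (clamp @` `[a, b]) `<=` O].
  exact: c z _ O_nbhs.
apply: filterS cz => z' z'O r rab; apply: z'O.
by exists (clamp r) => //; exists r; rewrite //= in_itv.
Qed.

Lemma start_near z : \forall z' \near z, start z' <=: start z.
Proof.
have c : {for z, continuous start}.
  apply: (@continuous_comp _ _ _ set_val fst); last exact: cvg_fst.
  exact: (@initial_continuous dom _ set_val).
exact: c (finite_near_spec_le _ fE).
Qed.

Lemma lift_point_exists z (t : R) : 0 <= t ->
  exists y, least_fence up dn (base_path z) 0 (start z) t y.
Proof.
by apply: (least_fence_exists upP dnP fE kE); [exact: base_path_below|exact: base_path0].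
Qed.

Definition lift_point (z : dom) (t : unit_interval R) : E :=
  projT1 (cid (lift_point_exists z (proj1 (andP (unit_intervalP t))))).

Lemma lift_pointP z t :
  least_fence up dn (base_path z) 0 (start z) (set_val t) (lift_point z t).
Proof. exact: projT2 (cid _). Qed.

Lemma lift_pointE z t y :
  least_fence up dn (base_path z) 0 (start z) (set_val t) y -> lift_point z t = y.
Proof.
move=> [fy ymin]; have [fl lmin] := lift_pointP z t.
by apply: spec_le_anti => //; [exact: lmin|exact: ymin].
Qed.

(** Semicontinuity in [z]: a nearby path is still dominated by [base_path z m] on each step, so any
    fence for it on that step stays below the given step. *)
Lemma fence_near z t y : fence up dn (base_path z) 0 (start z) t y ->
  \forall z' \near z, exists2 y',
    fence up dn (base_path z') 0 (start z') t y' & y' <=: y.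
Proof.
elim=> [|u {}y m v f IH uv /andP[um mv] gm].
  apply: filterS (start_near z) => z' z'z; exists (start z') => //.
  exact: fence_nil.
(* The degenerate interval [[v, v]] lets [base_path_near] control the single value at [v]. *)
have gv : forall r, v <= r <= v -> base_path z r <=: base_path z v.
  by move=> r; rewrite -eq_le => /eqP <-; exact: spec_le_refl.
have py := fence_fiber upP dnP (base_path0 z) f.
have [|yup pup _] := upP (e := y) (b := base_path z m).
  by rewrite py; apply: gm; rewrite lexx ltW.
have [|_ _ dnm] := dnP (e := up y (base_path z m)) (b := base_path z v).
  by rewrite pup; apply: gm; rewrite lexx ltW.
apply: filterS3 IH (base_path_near gm) (base_path_near gv) => z' [y' f' y'y] g'm g'v.
have py' := fence_fiber upP dnP (base_path0 z') f'.
have [w fw] := fence_exists up dn (@base_path_below z') py' (ltW uv).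
exists w; first exact: fence_cat f' fw.
apply: dnm.
  by apply: (fence_bound upP dnP py' fw); [exact: spec_le_trans y'y yup|rewrite pup].
by rewrite (fence_fiber upP dnP py' fw); apply: g'v; rewrite lexx.
Qed.

Lemma lift_point_before z (t : unit_interval R) : exists u y,
  [/\ 0 <= u <= set_val t, \forall s \near t, u <= set_val s,
      fence up dn (base_path z) 0 (start z) u y, y <=: lift_point z t &
      forall r, u <= r <= set_val t -> base_path z r <=: base_path z (set_val t)].
Proof.
have /andP[t0 _] := unit_intervalP t; have [f _] := lift_pointP z t.
move: t0; rewrite le_eqVlt => /orP[/eqP t0|t0].
  (* At time 0 there is no earlier time; the empty fence serves, since every [s] is nonnegative. *)
  exists 0, (start z); rewrite -t0 lexx; split=> //.
  - by apply: filterE => s; have /andP[] := unit_intervalP s.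
  - exact: fence_nil.
  - by move: f; rewrite -t0 => /fence_eq ->; exact: spec_le_refl.
  - by move=> r; rewrite -eq_le => /eqP <-; exact: spec_le_refl.
have [u [y [/andP[u0 ut] fy yl gl]]] :=
  fence_before upP dnP (@base_path_below z) (base_path0 z) f t0.
exists u, y; split=> //; first by rewrite u0 ltW.
have nu : nbhs (set_val t) [set r : R | u <= r].
  by apply: filterS (lt_nbhsr ut) => r /ltW.
exact: set_val_continuous nu.
Qed.

Lemma lift_point_continuous : continuous (uncurry lift_point).
Proof.
move=> [z t]; apply: cvg_spec_le; rewrite /=.
have [u [y [/andP[u0 ut] nu f yl gl]]] := lift_point_before z t.
have [e e0 ge] := locally_belowP (set_val t) (@base_path_below z).
have gl' r : u <= r <= set_val t + e / 2 -> base_path z r <=: base_path z (set_val t).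
  move=> /andP[ur rt]; have [rt'|tr] := leP r (set_val t); first by apply: gl; rewrite ur.
  by apply: ge; rewrite ltr_norml; apply/andP; split; lra.
have ne : \forall s \near t, set_val s <= set_val t + e / 2.
  have te : set_val t < set_val t + e / 2 by lra.
  have ne : nbhs (set_val t) [set r : R | r <= set_val t + e / 2].
    by apply: filterS (lt_nbhsl te) => r /ltW.
  exact: set_val_continuous ne.
(* For [(z', s)] in this product, reach [u] below [lift_point z t] and continue to [s] while the
   base stays below its value at [t]; [fence_bound] then gives the comparison. *)
exists ([set z' | (exists2 y', fence up dn (base_path z') 0 (start z') u y' & y' <=: y) /\
    forall r, u <= r <= set_val t + e / 2 -> base_path z' r <=: base_path z (set_val t)],
  [set s | u <= set_val s <= set_val t + e / 2]).
  split=> /=.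
    by apply: filterS2 (fence_near f) (base_path_near gl') => z'; split.
  by apply: filterS2 nu ne => s us st; apply/andP.
move=> [z' s] /= [[[y' f' y'y] g'] /andP[us st]].
have py' := fence_fiber upP dnP (base_path0 z') f'.
have [w fw] := fence_exists up dn (@base_path_below z') py' us.
apply: spec_le_trans ((lift_pointP z' s).2 _ (fence_cat f' fw)) _.
apply: (fence_bound upP dnP py' fw).
  exact: spec_le_trans y'y yl.
move=> r /andP[ur rs].
have [fl _] := lift_pointP z t.
rewrite (fence_fiber upP dnP (base_path0 z) fl).
by apply: g'; rewrite ur (le_trans rs st).
Qed.

Lemma lift_point_path_continuous z : continuous (lift_point z).
Proof. exact: (continuous_curry lift_point_continuous).2. Qed.

Definition fence_lifting (z : dom) : path_space R E :=
  (mkcts (@lift_point_path_continuous z) : continuousType (unit_interval R) E).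

Lemma fence_lifting_path_lifting : path_lifting_map fence_lifting.
Proof.
split.
- have : continuous (fun z : dom =>
      (fence_lifting z : {compact-open, unit_interval R -> E})).
    exact: continuous_curry_fun lift_point_continuous.
  move=> c z U [_ [[W oW <-] Wz WU]].
  have WzU : nbhs z [set z' : dom |
      W (fence_lifting z' : {compact-open, unit_interval R -> E})].
    exact: c z _ (open_nbhs_nbhs (conj oW Wz)).
  by apply: filterS WzU => z'; exact: WU.
- move=> z; apply: lift_pointE; split; first exact: fence_nil.
  by move=> y /fence_eq ->; exact: spec_le_refl.
- move=> z; apply/funext => t /=; have [f _] := lift_pointP z t.
  by rewrite (fence_fiber upP dnP (base_path0 z) f) /base_path clampK.
Qed.

Lemma fence_lifting_regular : regular_lifting fence_lifting.
Proof.
move=> e; apply: path_ext => t /=; have [f _] := lift_pointP (Defs.lift_cst R p e) t.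
have px r : base_path (Defs.lift_cst R p e) r = p e by [].
exact: (fence_cst upP dnP kE px f).
Qed.

Lemma fence_lifting_normalized : normalized_lifting fence_lifting.
Proof.
move=> z t; apply: path_ext => s; rewrite trunc_pathE /=.
apply: (lift_pointE (y := lift_point (lift_trunc z t) s)).
have gE r : 0 <= r <= set_val s ->
    base_path (lift_trunc z t) r = base_path z (r * set_val t).
  move=> /andP[r0 rs]; have /andP[s0 s1] := unit_intervalP s.
  have /andP[t0 t1] := unit_intervalP t.
  rewrite /base_path /=; congr ((set_val z).2 _).
  have r1 : 0 <= r <= 1 by rewrite r0 (le_trans rs).
  have rt1 : 0 <= r * set_val t <= 1.
    by rewrite mulr_ge0 //= mulr_ile1 // (le_trans rs).
  apply: unit_interval_inj; rewrite (clampE rt1).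
  by rewrite -[in RHS](clampE r1).
have [fl lmin] := lift_pointP (lift_trunc z t) s.
(* Rescaling needs [t > 0]; for [t = 0] the truncated path is constant and both lifts are
   [start z]. *)
have /andP[] := unit_intervalP t; rewrite le_eqVlt => /orP[/eqP t0|t0] t1.
  have -> : set_val (Imul s t) = 0 by rewrite set_valE /= -t0 mulr0.
  have <- : start z = lift_point (lift_trunc z t) s.
    have px r : base_path (lift_trunc z t) r = p (start z).
      rewrite base_path0 /base_path /= clamp0; congr ((set_val z).2 _).
      by apply: unit_interval_inj; rewrite set_valE /= -t0 mulr0.
    exact: esym (fence_cst upP dnP kE px fl).
  split=> [|y /fence_eq ->]; [exact: fence_nil|exact: spec_le_refl].
have -> : set_val (Imul s t) = set_val s * set_val t by [].
split.
  by have := fence_scale t0 (eq_fence gE fl); rewrite mul0r.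
move=> y f; apply: lmin; apply: (eq_fence (fun r rs => esym (gE r rs))).
pose g r := base_path z (r * set_val t).
(* Rescaling by the inverse turns fences of the original path into fences of the truncated one. *)
have ti : 0 < (set_val t)^-1 by rewrite invr_gt0.
have gK r : 0 <= r <= set_val s * set_val t ->
    base_path z r = g (r / set_val t).
  by move=> _; rewrite /g divfK // gt_eqF.
by have := fence_scale ti (eq_fence gK f); rewrite mul0r mulfK // gt_eqF.
Qed.

End fence_lifting.

(** * The order on subspaces, path spaces and pairs *)

Lemma set_val_spec_le (X : topologicalType) (A : set X) (x y : A) :
  x <=: y <-> set_val x <=: set_val y.
Proof.
split; first by apply: continuous_spec_le; exact: (@initial_continuous A X set_val).
move=> /spec_le_open xy; apply/spec_le_open => _ [V oV <-]; exact: xy.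
Qed.

Lemma cvg_principal_spec_le (X : topologicalType) (x y : X) :
  principal_filter x --> y -> x <=: y.
Proof.
move=> xy; apply/spec_le_open => U oU Uy.
exact: (xy _ (open_nbhs_nbhs (conj oU Uy)) x erefl).
Qed.

(** If [d] maps a compact [K] into an open [O], so does [c], because [O] is a down-set. *)
Lemma path_spec_le (R : realType) (T : topologicalType) (c d : path_space R T) :
  (forall t, c t <=: d t) -> c <=: d.
Proof.
move=> cd; apply/spec_le_open => _ [W oW <-] Wd.
have /spec_le_open : (c : {compact-open, unit_interval R -> T}) <=:
    (d : {compact-open, unit_interval R -> T}).
  apply: cvg_principal_spec_le; apply/compact_open_cvgP => K O _ oO dKO.
  move=> _ -> _ [t Kt <-]; have /spec_le_open := cd t; apply=> //.
  by apply: dKO; exists t.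
by apply.
Qed.

Lemma lift_domain_spec_le (R : realType) (E B : topologicalType) (p : E -> B)
    (z w : lift_domain R p) :
  (set_val z).1 <=: (set_val w).1 ->
  (forall t, (set_val z).2 t <=: (set_val w).2 t) -> z <=: w.
Proof.
move=> /spec_le_open zw1 /path_spec_le/spec_le_open zw2.
apply/set_val_spec_le/spec_le_open => U.
rewrite openE => /[apply] -[[P Q] [/= + +] PQU].
rewrite !nbhsE => -[P' [oP' P'w] P'P] [Q' [oQ' Q'w] Q'Q].
by apply: PQU; split; [apply: P'P; exact: zw1|apply: Q'Q; exact: zw2].
Qed.

(** At a minimal non-fixed [e], all smaller points are fixed, so by monotonicity [f e] is the
    maximum strictly below [e], both in [E] and, as [p (f e) = p e], in the fiber: [e] would be a
    down beat point of [p]. *)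
Lemma no_down_beat_rigid (E B : topologicalType) (p : E -> B) (f : E -> E) :
  finite_set [set: E] -> kolmogorov_space E ->
  (forall e, ~ map_down_beat_point p e) ->
  (forall x y, x <=: y -> f x <=: f y) -> (forall e, f e <=: e) ->
  (forall e, p (f e) = p e) -> forall e, f e = e.
Proof.
move=> fE kE nb fmono fle pf e0; apply: contrapT => ne0.
have [e fe emin] : exists2 e, f e <> e & forall x, f x <> x -> x <=: e -> x = e.
  by apply: (@finite_minimal _ [set e | f e <> e]) => //; exists e0.
have below x : spec_lt x e -> x <=: f e.
  move=> [xe nxe]; have <- : f x = x by apply: contrapT => /emin - /(_ xe).
  exact: fmono.
apply: (nb e); split; first by exists (f e).
exists (exist _ (f e) (mem_set (pf e : fiber p (p e) (f e)))).
  split; first by apply/set_val_spec_le; exact: fle.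
  by move=> /(congr1 set_val).
move=> x [/set_val_spec_le xe nxe]; apply/set_val_spec_le.
by apply: below; split=> // xeE; apply: nxe; exact: val_inj.
Qed.

(** * Monotone transport and the two kinds of lifts *)

Section transport.
Context (R : realType) (E B : topologicalType) (p : E -> B).
Context (fE : finite_set [set: E]) (kE : kolmogorov_space E).

Lemma nbhs_I0_pos (A : set (unit_interval R)) : nbhs (I0 R) A ->
  exists2 t, 0 < set_val t & A t.
Proof.
have -> : I0 R = clamp 0 by rewrite clamp0.
move=> /(@clamp_continuous R 0)/nbhs_ballP[e /= e0 eA].
have r0 : 0 < Num.min (e / 2) 1 by rewrite lt_min ltr01 andbT divr_gt0.
exists (clamp (Num.min (e / 2) 1)).
  by rewrite clampE // (ltW r0) ge_min lexx orbT.
apply: eA; rewrite /ball /= sub0r normrN gtr0_norm // gt_min.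
by apply/orP; left; lra.
Qed.

Lemma rigid_transport : hurewicz_fibration R p ->
  (forall e, ~ map_down_beat_point p e) ->
  exists t (T : lift_domain R p -> E),
    [/\ 0 < set_val t, forall z w, z <=: w -> T z <=: T w,
        forall z, p (T z) = (set_val z).2 t &
        forall e, T (Defs.lift_cst R p e) = e].
Proof.
move=> [cp hlp] nb.
pose H (zt : lift_domain R p * unit_interval R) : B := (set_val zt.1).2 zt.2.
have cv : continuous (set_val : lift_domain R p -> E * path_space R B).
  exact: initial_continuous.
have cH : continuous H.
  move=> zt.
  apply: (@continuous_comp _ _ _ (fun zt => ((set_val zt.1).2, zt.2))
    (fun ct : path_space R B * unit_interval R => ct.1 ct.2)).
    apply: (@cvg_pair _ _ _ (nbhs zt) (nbhs (set_val zt.1).2) (nbhs zt.2)); last exact: cvg_snd.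
    apply: (@continuous_comp _ _ _ fst (fun z => (set_val z).2)); first exact: cvg_fst.
    by apply: (@continuous_comp _ _ _ set_val snd); [exact: cv|exact: cvg_snd].
  exact: path_eval_continuous.
have cf : continuous (fun z : lift_domain R p => (set_val z).1).
  by move=> z; apply: (@continuous_comp _ _ _ set_val fst); [exact: cv|exact: cvg_fst].
have [G [cG G0 pG]] := hlp _ _ _ cf cH (@lift_domainP R E B p).
(* Over a constant path the lift starts at [e], hence is below [e] for small times; finiteness of
   [E] yields one time for all [e]. *)
have small : \forall t \near I0 R, forall e, G (Defs.lift_cst R p e, t) <=: e.
  apply: finite_filter_forall => // e.
  have c : continuous (fun t => G (Defs.lift_cst R p e, t)).
    exact: (continuous_curry cG).2.
  have := c (I0 R) _ (finite_near_spec_le _ fE).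
  by rewrite /= G0.
have [t t0 Gt] := nbhs_I0_pos small.
have mono z w : z <=: w -> G (z, t) <=: G (w, t).
  apply: (continuous_spec_le (f := fun z => G (z, t))).
  move=> x; apply: (@continuous_comp _ _ _ (fun z => (z, t)) G); last exact: cG.
  apply: (@cvg_pair _ _ _ (nbhs x) (nbhs x) (nbhs t)); first exact: cvg_id.
  exact: cvg_cst.
exists t, (fun z => G (z, t)); split=> //.
apply: (no_down_beat_rigid (p := p)) => //.
  move=> x y xy; apply: mono; apply: lift_domain_spec_le => [//|s] /=.
  exact: continuous_spec_le xy.
Qed.

Section lifts.
Context (t : unit_interval R) (T : lift_domain R p -> E).
Context (t0 : 0 < set_val t) (Tmono : forall z w, z <=: w -> T z <=: T w).
Context (pT : forall z, p (T z) = (set_val z).2 t).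
Context (Tcst : forall e, T (Defs.lift_cst R p e) = e).

Lemma transport_cst_le e (z : lift_domain R p) : e <=: (set_val z).1 ->
  (forall s, p e <=: (set_val z).2 s) -> e <=: T z.
Proof. by move=> ez pe; rewrite -[e]Tcst; apply: Tmono; apply: lift_domain_spec_le. Qed.

Lemma transport_le_cst e (z : lift_domain R p) : (set_val z).1 <=: e ->
  (forall s, (set_val z).2 s <=: p e) -> T z <=: e.
Proof. by move=> ze pe; rewrite -[e]Tcst; apply: Tmono; apply: lift_domain_spec_le. Qed.

Lemma cartesian_lift_exists : exists dn, cartesian_lift p dn.
Proof.
suff /choice[dn dnP] : forall eb : E * B, exists x, eb.2 <=: p eb.1 ->
    [/\ x <=: eb.1, p x = eb.2 & forall y, y <=: eb.1 -> p y <=: eb.2 -> y <=: x].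
  by exists (fun e b => dn (e, b)) => e b; exact: dnP (e, b).
(* When [b] is not below [p e] nothing is required and [e] is a default value. *)
move=> [e b] /=; have [bpe|?] := pselect (b <=: p e); last by exists e.
(* The path drops right after time 0: its lower value [b] is taken on the open set [s > 0], which
   contains [t]. *)
pose c (s : unit_interval R) : B := if set_val s == 0 then p e else b.
have cb s : b <=: c s.
  by rewrite /c; case: ifP => _; [exact: bpe|exact: spec_le_refl].
have cp s : c s <=: p e.
  by rewrite /c; case: ifP => _; [exact: spec_le_refl|exact: bpe].
have cc : continuous c.
  move=> s; apply: cvg_spec_le; have [s0|s0] := eqVneq (set_val s) 0.
    by apply: filterE => r; rewrite [c s]/c s0 eqxx; exact: cp.
  have sgt0 : 0 < set_val s by rewrite lt_def s0; have /andP[] := unit_intervalP s.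
  have : nbhs (set_val s) [set r : R | 0 < r] by exact: lt_nbhsr sgt0.
  move=> sN; have : \forall r \near s, 0 < set_val r by exact: set_val_continuous sN.
  apply: filterS => r r0.
  by rewrite /c (negPf s0) gt_eqF //; exact: spec_le_refl.
pose d : path_space R B := (mkcts cc : continuousType (unit_interval R) B).
have d0 : d (I0 R) = p e by rewrite /d /= /mkcts /c eqxx.
exists (T (lift_pair d0)) => _; split.
- by apply: transport_le_cst; [exact: spec_le_refl|exact: cp].
- by rewrite pT /= /mkcts /c gt_eqF.
- move=> y ye pyb; apply: transport_cst_le => //= s.
  exact: spec_le_trans pyb (cb s).
Qed.

Lemma opcartesian_lift_exists : exists up, opcartesian_lift p up.
Proof.
suff /choice[up upP] : forall eb : E * B, exists x, p eb.1 <=: eb.2 ->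
    [/\ eb.1 <=: x, p x = eb.2 & forall y, eb.1 <=: y -> eb.2 <=: p y -> x <=: y].
  by exists (fun e b => up (e, b)) => e b; exact: upP (e, b).
move=> [e b] /=; have [peb|?] := pselect (p e <=: b); last by exists e.
(* The rise happens exactly at [t]: the lower value [p e] occupies the open set [s < t], which
   contains 0, and [b] is reached at [t] itself. *)
pose c (s : unit_interval R) : B := if set_val s < set_val t then p e else b.
have cb s : c s <=: b.
  by rewrite /c; case: ifP => _; [exact: peb|exact: spec_le_refl].
have cp s : p e <=: c s.
  by rewrite /c; case: ifP => _; [exact: spec_le_refl|exact: peb].
have cc : continuous c.
  move=> s; apply: cvg_spec_le; have [st|ts] := ltP (set_val s) (set_val t); last first.
    by apply: filterE => r; rewrite [c s]/c ltNge ts; exact: cb.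
  have : nbhs (set_val s) [set r : R | r < set_val t] by exact: lt_nbhsl st.
  move=> sN; have : \forall r \near s, set_val r < set_val t.
    exact: set_val_continuous sN.
  apply: filterS => r rt.
  by rewrite /c st rt; exact: spec_le_refl.
pose d : path_space R B := (mkcts cc : continuousType (unit_interval R) B).
have d0 : d (I0 R) = p e by rewrite /d /= /mkcts /c t0.
exists (T (lift_pair d0)) => _; split.
- by apply: transport_cst_le; [exact: spec_le_refl|exact: cp].
- by rewrite pT /= /mkcts /c ltxx.
- move=> y ey bpy; apply: transport_le_cst => //= s.
  exact: spec_le_trans (cb s) bpy.
Qed.

End lifts.
End transport.

(** * From order-theoretic lifts to Grothendieck fibrations *)

Section bifibration.
Context (E B : topologicalType) (p : continuousType E B).

(** Arrows of a poset are proofs, so the lifting equation reduces to an equation between objects. *)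
Lemma existT_irrelevant (T : Type) (P : T -> Type) (x y : T) (h : P x) (k : P y) :
  (forall z (a b : P z), a = b) -> x = y -> existT P x h = existT P y k.
Proof. by move=> Pirr xy; subst y; rewrite (Pirr x h k). Qed.

Lemma cartesian_lift_fibration (dn : E -> B -> E) :
  cartesian_lift p dn -> grothendieck_fibration (space_functor p).
Proof.
move=> dnP e b be; have [dne pdn dnm] := dnP e b be.
exists (dn e b), dne; split; last first.
  by apply: existT_irrelevant => // z; exact: (@Prop_irrelevance (z <=: p e)).
move=> x xe px _; have xb : x <=: dn e b by apply: dnm => //; rewrite -pdn.
exists xb; split; last by move=> k _; exact: (@Prop_irrelevance (x <=: dn e b)).
split; first exact: (@Prop_irrelevance (x <=: e)).
exact: (@Prop_irrelevance (p x <=: p (dn e b))).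
Qed.

Lemma opcartesian_lift_opfibration (up : E -> B -> E) :
  opcartesian_lift p up -> grothendieck_opfibration (space_functor p).
Proof.
move=> upP e b be; have [upe pup upm] := upP e b be.
exists (up e b), upe; split; last first.
  by apply: existT_irrelevant => // z; exact: (@Prop_irrelevance (p e <=: z)).
move=> x xe px _; have xb : up e b <=: x by apply: upm => //; rewrite -pup.
exists xb; split; last by move=> k _; exact: (@Prop_irrelevance (up e b <=: x)).
split; first exact: (@Prop_irrelevance (e <=: x)).
exact: (@Prop_irrelevance (p (up e b) <=: p x)).
Qed.

End bifibration.

Theorem theorem6p21 (R : realType) (E B : topologicalType)
    (p : continuousType E B) :
  finite_set [set: E] -> kolmogorov_space E ->
  finite_set [set: B] -> kolmogorov_space B ->
  [set: E] !=set0 ->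
  hurewicz_fibration R p ->
  (forall e : E, ~ map_down_beat_point p e) ->
  (exists L : lift_domain R p -> path_space R E,
     [/\ path_lifting_map L, regular_lifting L & normalized_lifting L]) /\
  grothendieck_bifibration (space_functor p).
Proof.
move=> fE kE fB _ _ hp nb.
have [t [T [t0 Tmono pT Tcst]]] := rigid_transport fE kE hp nb.
have [dn dnP] := cartesian_lift_exists t0 Tmono pT Tcst.
have [up upP] := opcartesian_lift_exists t0 Tmono pT Tcst.
split; last first.
  split; first exact: cartesian_lift_fibration dnP.
  exact: opcartesian_lift_opfibration upP.
exists (fence_lifting upP dnP fE kE fB); split.
- exact: fence_lifting_path_lifting.
- exact: fence_lifting_regular.
- exact: fence_lifting_normalized.
Qed.
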